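(* For all integers $m<0$ and $n\geq 1$, \[ M(\leq m,n)\leq N(\leq m+1,n). \]
   Context: For a partition $\lambda$, $\operatorname{rank}(\lambda)$ is its largest part minus its number of parts. $\operatorname{crank}(\lambda)$ is the largest part of $\lambda$ if $\lambda$ contains no part equal to $1$; otherwise it is the number of parts larger than the number of ones minus the number of ones. For $n\geq 1$, $N(m,n)$ is the number of partitions of $n$ with rank $m$. For $n>1$, $M(m,n)$ is the number of partitions of $n$ with crank $m$. For $n=1$ one sets $M(0,1)=-1$, $M(1,1)=M(-1,1)=1$ and $M(m,1)=0$ for $m\notin\{-1,0,1\}$. The cumulative functions are $N(\leq m,n)=\sum_{r\leq m}N(r,n)$ and $M(\leq m,n)=\sum_{r\leq m}M(r,n)$. *)

(* Defs.v *)
From mathcomp Require Import all_boot all_order all_algebra.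
Set Implicit Arguments. Unset Strict Implicit. Unset Printing Implicit Defensive.
Import Order.TTheory GRing.Theory Num.Theory.
Local Open Scope ring_scope.

(* A partition of n is represented by its multiplicity function:
   mu : {ffun 'I_n -> 'I_n.+1}, where mu i is the number of parts equal to i.+1.
   (Every part of a partition of n is in 1..n and occurs at most n times, so
   this is a bijective encoding of the partitions of n.) *)
Definition mults (n : nat) := {ffun 'I_n -> 'I_n.+1}.

Definition is_partition (n : nat) (mu : mults n) : bool :=
  (\sum_(i < n) i.+1 * mu i)%N == n.

Definition nparts n (mu : mults n) : nat := (\sum_(i < n) mu i)%N.
Definition largest n (mu : mults n) : nat := (\max_(i < n | 0 < mu i) i.+1)%N.
Definition nones n (mu : mults n) : nat :=
  (\sum_(i < n | i == 0%N :> nat) mu i)%N.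
Definition nparts_gt_ones n (mu : mults n) : nat :=
  (\sum_(i < n | nones mu < i.+1) mu i)%N.

Definition prank n (mu : mults n) : int := (largest mu)%:Z - (nparts mu)%:Z.

Definition pcrank n (mu : mults n) : int :=
  if nones mu == 0%N then (largest mu)%:Z
  else (nparts_gt_ones mu)%:Z - (nones mu)%:Z.

Definition Nrank (m : int) (n : nat) : int :=
  #|[set mu : mults n | is_partition mu & prank mu == m]|%:Z.

(* M(m,n), with the convention for n = 1 *)
Definition Mcrank (m : int) (n : nat) : int :=
  if n == 1%N then
    (if m == 0 then -1 else if (m == 1) || (m == -1) then 1 else 0)
  else #|[set mu : mults n | is_partition mu & pcrank mu == m]|%:Z.

(* Cumulative F(<= m, n) = sum_{r <= m} F(r,n).  For n >= 1 both N(r,n) and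
   M(r,n) vanish for r outside [-n, n], so the infinite sum equals the sum over
   r in [-n, n] with r <= m. *)
Definition cumul (F : int -> nat -> int) (m : int) (n : nat) : int :=
  \sum_(k < (2 * n).+1 | k%:Z - n%:Z <= m) F (k%:Z - n%:Z) n.

(* Main.v *)
(* Write j = -m-1.  The proof compares three sets of partitions lambda of n, in
   terms of the conjugate f of lambda (indices from 0):
   (i) crank(lambda) <= -(j+1);
   (ii) lambda_d = d+1+j for some d, which reads f(j+d+1) <= d < f(j+d);
   (iii) rank(lambda) <= -j.
   From (i) to (ii), by downward induction on j.  Merging the w ones of a partition
   of crank -(j+1) into a single part w gives a partition satisfying (ii) for j
   but not for j+1; a partition satisfying (ii) for j+1 but not for j is sent to
   one satisfying (ii) for j but not for j+1 by splitting a one off the part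
   j+d+2, and the two images are told apart by the number of ones.
   From (ii) to (iii), up to conjugation: let g have rank less than j and
   g(e) = e+1+j.  Delete the row g(e), delete the first column from the rows below
   it, and put the removed cells into a new first row.  The result has rank at
   least j and no row of length i+1+j at index i, and e is recovered as the last
   index i whose row has length at least i+j. *)
Require Import Defs.
From mathcomp Require Import all_boot all_order all_algebra.
From mathcomp Require Import zify.
From Stdlib Require Import FunctionalExtensionality.
Set Implicit Arguments. Unset Strict Implicit. Unset Printing Implicit Defensive.
Import Order.TTheory GRing.Theory Num.Theory.
Local Open Scope nat_scope.

(** * Conjugate partitions as functions *)

(* Number of parts larger than [i], i.e. row [i] of the conjugate diagram. *)
Definition tail n (mu : mults n) (i : nat) : nat := \sum_(k < n | i <= k) mu k.

Definition is_row n (f : nat -> nat) : Prop :=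
  [/\ forall i, f i.+1 <= f i, f n = 0 & \sum_(i < n) f i = n].

(** Inverse of [tail] on rows; [inord] never truncates there, since the differences are at most
    n. *)
Definition of_row n (f : nat -> nat) : mults n :=
  [ffun k : 'I_n => inord (f k - f k.+1)].

Definition cnt n (Q : pred (nat -> nat)) : nat :=
  #|[set mu : mults n | is_partition mu & Q (tail mu)]|.

Lemma row_decr n (f : nat -> nat) i k : is_row n f -> i <= k -> f k <= f i.
Proof.
case=> H _ _; elim: k => [|k IH]; first by rewrite leqn0 => /eqP ->.
rewrite leq_eqVlt => /orP[/eqP -> //|]; rewrite ltnS => /IH; exact: leq_trans.
Qed.

Lemma row_eq0 n (f : nat -> nat) i : is_row n f -> n <= i -> f i = 0.
Proof. by move=> H /(row_decr H); case: H => _ -> _; lia. Qed.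

Lemma row_le n (f : nat -> nat) i : is_row n f -> f i <= n.
Proof.
move=> Hf; have [ni|lin] := leqP n i; first by rewrite (row_eq0 Hf ni).
by case: Hf => _ _ <-; rewrite (bigD1 (Ordinal lin)) //= leq_addr.
Qed.

Lemma tail_split n (mu : mults n) (k : 'I_n) : tail mu k = mu k + tail mu k.+1.
Proof.
rewrite /tail (bigD1 k) //=; congr (_ + _); apply: eq_bigl => i.
by rewrite ltn_neqAle andbC eq_sym.
Qed.

Lemma tail_ge n (mu : mults n) i : n <= i -> tail mu i = 0.
Proof. by move=> ni; rewrite /tail big_pred0 // => k; have := ltn_ord k; lia. Qed.

Lemma sum_tail n (mu : mults n) :
  \sum_(i < n) tail mu i = \sum_(i < n) i.+1 * mu i.
Proof.
rewrite /tail (exchange_big_dep predT) //=; apply: eq_bigr => k _.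
rewrite sum_nat_const -[in RHS](card_ord k.+1) -!sum1_card; congr (_ * _).
by rewrite (big_ord_widen n (fun=> 1)).
Qed.

Lemma is_row_tail n (mu : mults n) : is_partition mu -> is_row n (tail mu).
Proof.
move=> /eqP Hmu; split; last by rewrite sum_tail.
- move=> i; have [ni|lin] := leqP n i; first by rewrite !tail_ge // leqW.
  by rewrite (tail_split mu (Ordinal lin)) /= leq_addl.
- exact: tail_ge.
Qed.

Lemma tail_inj n (mu nu : mults n) : tail mu =1 tail nu -> mu = nu.
Proof.
move=> E; apply/ffunP => k; apply/val_inj.
by have := E k; rewrite !tail_split E => /addIn.
Qed.

Lemma tail_of_row n f : is_row n f -> tail (of_row n f) =1 f.
Proof.
move=> Hf i; have [m] := ubnP (n - i); elim: m i => // m IH i ltm.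
have [ni|lin] := leqP n i; first by rewrite tail_ge // (row_eq0 Hf).
rewrite (tail_split _ (Ordinal lin)) /= IH; last lia.
have [decr _ _] := Hf; rewrite ffunE inordK ?subnK //=.
by rewrite ltnS; apply: leq_trans (leq_subr _ _) (row_le i Hf).
Qed.

Lemma is_partition_of_row n f : is_row n f -> is_partition (of_row n f).
Proof.
move=> Hf; rewrite /is_partition -sum_tail; apply/eqP.
under eq_bigr => i _ do rewrite tail_of_row //.
by case: Hf.
Qed.

Lemma cnt_inj n (Q R : pred (nat -> nat)) (F : (nat -> nat) -> nat -> nat) :
    (forall f, is_row n f -> Q f -> is_row n (F f) /\ R (F f)) ->
    (forall f g, is_row n f -> Q f -> is_row n g -> Q g -> F f =1 F g -> f =1 g) ->
  cnt n Q <= cnt n R.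
Proof.
move=> HF injF; pose h (mu : mults n) := of_row n (F (tail mu)).
rewrite /cnt -(card_in_imset (f := h)).
  apply/subset_leq_card/subsetP => _ /imsetP[mu /[!inE]/andP[Pmu Qmu] ->].
  have [rF RF] := HF _ (is_row_tail Pmu) Qmu.
  rewrite is_partition_of_row //=.
  by rewrite (functional_extensionality _ _ (tail_of_row rF)).
move=> mu nu /[!inE]/andP[Pmu Qmu] /andP[Pnu Qnu] E.
have [rmu _] := HF _ (is_row_tail Pmu) Qmu.
have [rnu _] := HF _ (is_row_tail Pnu) Qnu.
apply: tail_inj; apply: injF => //; try exact: is_row_tail.
by move=> i; rewrite -(tail_of_row rmu) -(tail_of_row rnu) -/(h mu) E.
Qed.

Lemma cntID n (Q R : pred (nat -> nat)) :
  cnt n Q = cnt n (fun f => Q f && R f) + cnt n (fun f => Q f && ~~ R f).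
Proof.
rewrite /cnt -(cardsID [set mu : mults n | R (tail mu)]); congr (_ + _).
  by apply: eq_card => mu; rewrite !inE andbA.
by apply: eq_card => mu; rewrite !inE andbC andbA.
Qed.

Lemma sub_cnt n (Q R : pred (nat -> nat)) :
  (forall f, is_row n f -> Q f -> R f) -> cnt n Q <= cnt n R.
Proof. by move=> sQR; apply: (cnt_inj (F := id)) => // f rf /(sQR f rf). Qed.

Lemma sum_eqn n a : \sum_(i < n) (i == a :> nat) = (a < n).
Proof. by elim: n => [|n IH]; rewrite ?big_ord0 // big_ord_recr /= IH; lia. Qed.

Lemma sum_ltn n a : \sum_(i < n) (i < a) = minn a n.
Proof.
by elim: n => [|n IH]; rewrite ?big_ord0 ?minn0 // big_ord_recr /= IH; lia.
Qed.

(** * Crank *)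

(** A shifted Durfee square: for a row function, the largest d such that d columns and j + d + 1
    rows fit into [f]. *)
Definition depth j n (f : nat -> nat) : nat :=
  find (fun d => f (j + d).+1 <= d) (iota 0 n.+1).

(** Row d of the conjugate of [f] has length d + 1 + j for some d; only the depth can be such a d,
    so the test is made there. *)
Definition has_hole j n : pred (nat -> nat) :=
  fun f => depth j n f < f (j + depth j n f).

Lemma depthP j n f : is_row n f ->
  f (j + depth j n f).+1 <= depth j n f /\
  (forall e, e < depth j n f -> e < f (j + e).+1).
Proof.
move=> Hf; have Hh : has (fun d => f (j + d).+1 <= d) (iota 0 n.+1).
  apply/hasP; exists n; rewrite ?mem_iota ?(row_eq0 Hf) //; lia.
have := Hh; rewrite has_find size_iota => lt_n; split.
  by have := nth_find 0 Hh; rewrite nth_iota ?add0n.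
move=> e lt_e; have := before_find 0 lt_e.
rewrite nth_iota ?add0n; last exact: ltn_trans lt_n.
by rewrite ltnNge => ->.
Qed.

Lemma depth_uniq j n f d : is_row n f ->
  f (j + d).+1 <= d -> d <= f (j + d) -> depth j n f = d.
Proof.
move=> Hf le_d ge_d; have [le_h lt_h] := depthP j Hf.
have [ltd|ltd|//] := ltngtP (depth j n f) d; last first.
  by have := lt_h _ ltd; lia.
have := @row_decr n f (j + depth j n f).+1 (j + d) Hf; lia.
Qed.

Lemma has_holeP j n f d : is_row n f -> f (j + d).+1 <= d < f (j + d) ->
  has_hole j n f /\ depth j n f = d.
Proof.
move=> Hf /andP[le_d lt_d].
have E : depth j n f = d by apply: depth_uniq => //; apply: ltnW.
by rewrite /has_hole E.
Qed.

Lemma no_hole j n f d : is_row n f -> f (j + d) = d -> ~~ has_hole j n f.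
Proof.
move=> Hf fd; rewrite /has_hole -leqNgt; have [le_h lt_h] := depthP j Hf.
have [ltd|led] := ltnP (depth j n f) d.
  by have := @row_decr n f (j + depth j n f).+1 (j + d) Hf; lia.
by have := @row_decr n f (j + d) (j + depth j n f) Hf; lia.
Qed.

(* [f 0 - f 1] is the number of ones, and [f (f 0 - f 1)] the number of parts
   exceeding it. *)
Definition crank_le j : pred (nat -> nat) :=
  fun f => f (f 0 - f 1) + j < f 0 - f 1.

Definition crank_eq j : pred (nat -> nat) :=
  fun f => f (f 0 - f 1) + j.+1 == f 0 - f 1.

(* For [f] with a hole at depth [d] and [f (j + d).+1 = d]: there is a one besides
   the last part of size [j + d + 1].  That part is itself a one iff j = d = 0. *)
Definition spare_one j : pred (nat -> nat) :=
  fun f => f 1 + ((j == 0) && (f 1 == 0)) < f 0.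

(** With w = f 0 - f 1 > 0, dropping the ones lowers index 0 to f 1, and the new part w adds 1 to
    each index below w. *)
Definition merge_ones (f : nat -> nat) (i : nat) : nat :=
  if i == 0 then (f 1).+1 else if i < f 0 - f 1 then (f i).+1 else f i.

Definition split_one j n (f : nat -> nat) (i : nat) : nat :=
  if i == 0 then (f 0).+1
  else if i == (j + depth j.+1 n f).+1 then (f i).-1 else f i.

Lemma merge_onesP j n f : is_row n f -> crank_eq j f ->
  [/\ is_row n (merge_ones f), has_hole j n (merge_ones f),
      depth j n (merge_ones f) = f (f 0 - f 1), ~~ has_hole j.+1 n (merge_ones f)
    & ~~ spare_one j (merge_ones f)].
Proof.
move=> Hf /eqP Hc.
set w := f 0 - f 1 in Hc; have [decr _ Sf] := Hf.
have w_n : w <= n by have := row_le 0 Hf; lia.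
have decr1 k : 0 < k -> f k <= f 1 by move=> k0; apply: (row_decr Hf).
have rF : is_row n (merge_ones f).
  split; rewrite /merge_ones -/w.
  - move=> [|i] /=; first by case: ifP; lia.
    by have := decr i.+1; case: ifP; case: ifP; lia.
  - by have := row_eq0 Hf (leqnn n); do 2?[case: ifP]; lia.
  - have : \sum_(i < n) (merge_ones f i + w * (i == 0 :> nat)) =
           \sum_(i < n) (f i + (i < w)).
      apply: eq_bigr => -[[|i] lti] _; rewrite /merge_ones -/w /=; first lia.
      by case: ifP; lia.
    by rewrite !big_split -big_distrr /= sum_eqn sum_ltn /merge_ones -/w Sf; nia.
have Fw : merge_ones f w = f w.
  by rewrite /merge_ones -/w ltnn; case: eqP => //; lia.
have w1 : f w < merge_ones f w.-1.
  rewrite /merge_ones -/w; case: eqP => [w1|_].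
    by have -> : w = 1; lia.
  by have := decr w.-1; rewrite prednK; [case: ifP; lia|lia].
have [|hF dF] := @has_holeP j n (merge_ones f) (f w) rF.
  have -> : (j + f w).+1 = w by lia.
  by have -> : j + f w = w.-1; [lia|rewrite Fw leqnn].
split=> //; first by apply: (no_hole (d := f w)) => //; rewrite addSn addnC -addnS Hc.
rewrite /spare_one /merge_ones -/w /= -leqNgt.
case: ifP => [|w1']; first lia.
(* Here the crank equation leaves j = 0 and f 1 = 0, the case that the correction in [spare_one] is
   made for. *)
have E1 : w = 1 by lia.
by rewrite E1 in Hc; lia.
Qed.

Lemma crank_eq_le j n :
  cnt n (crank_eq j) <=
  cnt n (fun f => has_hole j n f && ~~ has_hole j.+1 n f && ~~ spare_one j f).
Proof.
apply: (cnt_inj (F := merge_ones)) => [f Hf fc|f g Hf fc Hg gc E].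
  by case: (merge_onesP Hf fc) => ? -> _ -> ->.
have [rf _ df _ _] := merge_onesP Hf fc; have [_ _ dg _ _] := merge_onesP Hg gc.
move: df; rewrite (functional_extensionality _ _ E) dg => Ed.
have Ew : f 0 - f 1 = g 0 - g 1 by move/eqP: fc; move/eqP: gc; lia.
have E1 : f 1 = g 1 by have := E 0; rewrite /merge_ones /=; case.
move=> [|i]; first by move/eqP: fc; move/eqP: gc; lia.
by have := E i.+1; rewrite /merge_ones Ew /=; case: ifP => // _ [].
Qed.

Lemma split_oneP j n f : is_row n f -> has_hole j.+1 n f -> ~~ has_hole j n f ->
  [/\ is_row n (split_one j n f), has_hole j n (split_one j n f),
      depth j n (split_one j n f) = depth j.+1 n f,
      ~~ has_hole j.+1 n (split_one j n f) & spare_one j (split_one j n f)].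
Proof.
move=> Hf Hh Hnh; have [decr fn Sf] := Hf; have [le_h _] := depthP j.+1 Hf.
move: Hh; rewrite /has_hole; set d := depth j.+1 n f in le_h *.
rewrite !addSn in le_h * => Hh.
(* A larger value would give a hole for [j] at depth d + 1. Taking one cell off thus leaves exactly
   d, which opens a hole for [j] and closes the one for [j.+1]. *)
have fd : f (j + d).+1 = d.+1.
  have [//|gt_d|//] := ltngtP (f (j + d).+1) d.+1; first lia.
  have [|] := @has_holeP j n f d.+1 Hf; last by rewrite (negbTE Hnh).
  by rewrite !addnS gt_d andbT; apply: leq_trans le_h _.
have jdn : (j + d).+1 < n.
  by rewrite ltnNge; apply/negP => /(row_eq0 Hf); rewrite fd.
have rF : is_row n (split_one j n f).
  split; rewrite /split_one -/d.
  - move=> [|i] /=; first by have := decr 0; case: ifP; lia.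
    have := decr i.+1; case: eqP => [_|_]; first by case: eqP; lia.
    by case: eqP => [[->]|_] //; move: le_h fd; lia.
  - by case: ifP => [|_]; [lia|rewrite fn; case: ifP].
  - have : \sum_(i < n) (split_one j n f i + (i == (j + d).+1 :> nat)) =
           \sum_(i < n) (f i + (i == 0 :> nat)).
      apply: eq_bigr => -[[|i] lti] _; rewrite /split_one -/d /=; first lia.
      by case: eqP => [->|_]; rewrite ?fd; lia.
    by rewrite !big_split /= !sum_eqn /split_one -/d Sf; lia.
have Fd : split_one j n f (j + d).+1 = d by rewrite /split_one -/d eqxx fd.
have [|hF dF] := @has_holeP j n (split_one j n f) d rF.
  rewrite Fd leqnn /= /split_one -/d; have := row_decr Hf (leqnSn (j + d)).
  by rewrite fd; case: ifP => [/eqP ->|_]; [|case: ifP]; lia.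
split=> //; first by apply: (no_hole (d := d)).
have := @row_decr n f 1 (j + d).+1 Hf isT; have := decr 0.
by rewrite /spare_one /split_one -/d /= fd; case: eqP => [E|_]; [move: fd; rewrite -E|]; lia.
Qed.

Lemma split_one_le j n :
  cnt n (fun f => has_hole j.+1 n f && ~~ has_hole j n f) <=
  cnt n (fun f => has_hole j n f && ~~ has_hole j.+1 n f && spare_one j f).
Proof.
apply: (cnt_inj (F := split_one j n)).
  by move=> f Hf /andP[h h']; case: (split_oneP Hf h h') => ? -> _ -> ->.
move=> f g Hf /andP[hf hf'] Hg /andP[hg hg'] E.
have [_ _ df _ _] := split_oneP Hf hf hf'.
have [_ _ dg _ _] := split_oneP Hg hg hg'.
move: df; rewrite (functional_extensionality _ _ E) dg => Ed.
move=> i; have := E i; rewrite /split_one Ed; case: eqP => [-> []|_] //.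
case: eqP => [Ei|_] //.
by move: hf hg; rewrite /has_hole Ed !addSn Ei; lia.
Qed.

Lemma crank_le_hole j n : cnt n (crank_le j) <= cnt n (has_hole j n).
Proof.
have [m] := ubnP (n - j); elim: m j => // m IH j ltm.
(* For j >= n, a crank of at most -(j+1) would need more than n ones. *)
have [nj|jn] := leqP n j.
  apply: sub_cnt => f Hf; rewrite /crank_le; have := row_le 0 Hf; lia.
(* Crank exactly -(j+1) goes to the holes without a spare one; smaller cranks are bounded by
   induction and go to the other two classes. *)
rewrite (cntID n (crank_le j) (crank_eq j)) [X in _ <= X](cntID n _ (has_hole j.+1 n)).
rewrite [X in _ <= _ + X](cntID n _ (spare_one j)).
apply: (@leq_trans (cnt n (crank_eq j) + cnt n (crank_le j.+1))).
  by apply: leq_add; apply: sub_cnt => f Hf; rewrite /crank_le /crank_eq; lia.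
have {}IH : cnt n (crank_le j.+1) <= cnt n (has_hole j.+1 n) by apply: IH; lia.
apply: (leq_trans (leq_add (crank_eq_le j n) IH)).
rewrite [X in _ + X <= _](cntID n _ (has_hole j n)).
have := split_one_le j n; set u := cnt _ _; set v := cnt _ _ => uv.
rewrite addnC -addnA; apply: leq_add; last by rewrite leq_add2r.
by apply: sub_cnt => f _ /andP[-> ->].
Qed.

(** * Rank *)

Definition conj n (f : nat -> nat) (i : nat) : nat := \sum_(k < n) (i < f k).

Lemma conjP n f i k : is_row n f -> (k < conj n f i) = (i < f k).
Proof.
move=> Hf; have [lt_if|le_fi] := ltnP i (f k).
  have lt_kn : k < n by rewrite ltnNge; apply/negP => /(row_eq0 Hf); lia.
  have <- : \sum_(l < n) (l < k.+1) = k.+1 by rewrite sum_ltn; lia.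
  apply: leq_sum => l _; have [lk|] := ltnP l k.+1 => //.
  by rewrite (leq_trans lt_if) // (row_decr Hf).
apply/negbTE; rewrite -leqNgt; apply: leq_trans (geq_minl k n).
rewrite -sum_ltn; apply: leq_sum => l _; have [_|kl] := ltnP l k; first by rewrite leq_b1.
by rewrite ltnNge (leq_trans (row_decr Hf kl)).
Qed.

Lemma is_row_conj n f : is_row n f -> is_row n (conj n f).
Proof.
move=> Hf; split.
- move=> i; apply: leq_sum => k _; have [/ltnW -> //|//] := ltnP i.+1 (f k).
- by apply: big1 => k _; rewrite ltnNge (row_le k Hf).
- rewrite exchange_big /=.
  under eq_bigr => k _ do rewrite sum_ltn (minn_idPl (row_le k Hf)).
  by case: Hf.
Qed.

Lemma conj_inj n f g : is_row n f -> is_row n g -> conj n f =1 conj n g -> f =1 g.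
Proof.
move=> Hf Hg E k; have H i : (i < f k) = (i < g k) by rewrite -(conjP _ _ Hf) E conjP.
by apply/eqP; rewrite eqn_leq leqNgt H ltnn leqNgt -H ltnn.
Qed.

(** * Rows on a shifted diagonal and insertion of a new first row *)

Definition diag j n (f : nat -> nat) : nat :=
  find (fun e => f e <= e + j.+1) (iota 0 n.+1).

Definition has_diag j n : pred (nat -> nat) :=
  fun f => f (diag j n f) == diag j n f + j.+1.

(** As f e - e strictly decreases, it equals j + 1 at most once, and then at the first e where it is
    at most j + 1. *)
Lemma has_diagP j n f e : is_row n f -> f e = e + j.+1 -> has_diag j n f.
Proof.
move=> Hf fe; rewrite /has_diag.
have Hh : has (fun e => f e <= e + j.+1) (iota 0 n.+1).
  apply/hasP; exists n; rewrite ?mem_iota ?(row_eq0 Hf) //; lia.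
have lt_n := Hh; rewrite has_find size_iota -/(diag j n f) in lt_n.
have := nth_find 0 Hh; rewrite nth_iota // add0n -/(diag j n f) => le_d.
have [lt_de|lt_ed|->] := ltngtP (diag j n f) e; last exact/eqP.
  by have := @row_decr n f _ _ Hf (ltnW lt_de); lia.
have := before_find 0 lt_ed; rewrite nth_iota ?add0n; last exact: ltn_trans lt_n.
by rewrite fe leqnn.
Qed.

Lemma hole_diag j n : cnt n (has_hole j n) <= cnt n (has_diag j n).
Proof.
apply: (cnt_inj (F := conj n)) => [f Hf Hh|f g Hf _ Hg _]; last exact: conj_inj.
split; first exact: is_row_conj.
apply: (has_diagP (e := depth j n f)); first exact: is_row_conj.
have [le_h _] := depthP j Hf.
have := conjP (depth j n f) (j + depth j n f) Hf.
have := conjP (depth j n f) (j + depth j n f).+1 Hf.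
by move: Hh; rewrite /has_hole; lia.
Qed.

(** The rank of the partition with rows [f] is at least j; for [f = tail mu], this says that [mu]
    has rank at most -j. *)
Definition rank_ge j n : pred (nat -> nat) := fun f => conj n f 0 + j <= f 0.

(* If the row above [e] has the same length as row [e], moving it down to index
   [e] would recreate a row of length [e + j.+1] there, so one of its cells goes
   to row 0. *)
Definition flat j n (f : nat -> nat) : bool :=
  let e := diag j n f in (0 < e) && (f e.-1 == f e).

(** If [f] has l rows and e is the diagonal index, row e gives e + j + 1 cells and the rows below it
    give l - e - 1, so the new first row has j + l cells, plus one in the flat case. *)
Definition add_row j n (f : nat -> nat) (i : nat) : nat :=
  if i == 0 then j + conj n f 0 + flat j n f
  else if i <= diag j n f then f i.-1 - (flat j n f && (i == diag j n f))
  else (f i).-1.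

Lemma sum_add_row j n f : is_row n f -> has_diag j n f ->
  \sum_(i < n) add_row j n f i = n.
Proof.
move=> Hf /eqP; set e := diag j n f => fe; set t := flat j n f.
have t0 : t -> 0 < e by move=> /andP[].
have SA N : N < e ->
    \sum_(i < N.+1) add_row j n f i = j + conj n f 0 + t + \sum_(i < N) f i.
  elim: N => [|N IH] ltN; first by rewrite big_ord1 big_ord0 addn0.
  rewrite big_ord_recr /= IH ?(ltnW ltN) // [in RHS]big_ord_recr /= addnA.
  by rewrite /add_row /= -/e ltnW //; case: eqP => [|_]; [lia|rewrite andbF subn0].
have SB : \sum_(i < e.+1) add_row j n f i = j + conj n f 0 + \sum_(i < e) f i.
  case E: e SA t0 fe => [|e'] SA t0 fe.
    by rewrite big_ord1 big_ord0 /add_row /= -/t; lia.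
  rewrite big_ord_recr /= SA // [in RHS]big_ord_recr /=.
  rewrite /add_row /= -/e -/t E ltnSn eqxx andbT.
  by have := @row_decr n f e' e'.+1 Hf (leqnSn _); lia.
(* The balance of removed cells, free of subtraction; once the range reaches n, the sum of
   indicators is the number of rows. *)
have SC r : \sum_(i < e.+1 + r) add_row j n f i + f e + \sum_(i < e.+1 + r) (0 < f i) =
    j + conj n f 0 + \sum_(i < e.+1 + r) f i + e.+1.
  elim: r => [|r IH].
    rewrite addn0 SB [in RHS]big_ord_recr /=.
    suff -> : \sum_(i < e.+1) (0 < f i) = e.+1 by lia.
    rewrite -[RHS](minnn e.+1) -sum_ltn; apply: eq_bigr => i _.
    by have := @row_decr n f i e Hf; have := ltn_ord i; lia.
  rewrite addnS !(@big_ord_recr _ _ _ (e.+1 + r)) /= {2}/add_row /= -/e.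
  have -> : (e + r).+1 <= e = false by lia.
  by move: IH; case: (f (e.+1 + r)) => [|x] /=; lia.
have en : e < n by rewrite ltnNge; apply/negP => /(row_eq0 Hf); lia.
have := SC (n - e.+1); rewrite subnKC // -/(conj n f 0).
by have [_ _ ->] := Hf; lia.
Qed.

Lemma add_rowP j n f : is_row n f -> has_diag j n f -> ~~ rank_ge j n f ->
  [/\ is_row n (add_row j n f), rank_ge j n (add_row j n f),
      ~~ has_diag j n (add_row j n f),
      forall i, (i + j <= add_row j n f i) = (i <= diag j n f)
    & flat j n f = (add_row j n f (diag j n f) == diag j n f + j)].
Proof.
move=> Hf Hd; have SF := sum_add_row Hf Hd; have [decr fn _] := Hf.
have /eqP := Hd; rewrite /rank_ge -ltnNge; set e := diag j n f => fe lt_rk.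
have en : e < n by rewrite ltnNge; apply/negP => /(row_eq0 Hf); lia.
have le_e i : i <= e -> e + j.+1 <= f i by move=> /(row_decr Hf); rewrite fe.
have ge_e i : e <= i -> f i <= e + j.+1 by move=> /(row_decr Hf); rewrite fe.
have F0 : add_row j n f 0 = j + conj n f 0 + flat j n f by [].
have Flt i : i.+1 < e -> add_row j n f i.+1 = f i.
  by move=> ie; rewrite /add_row -/e /= ltnW // ltn_eqF // andbF subn0.
have Feq i : i.+1 = e -> add_row j n f i.+1 = f i - flat j n f.
  by move=> ie; rewrite /add_row -/e /= -ie leqnn eqxx andbT.
have Fgt i : e < i -> add_row j n f i = (f i).-1.
  by case: i => // i ie; rewrite /add_row -/e /= leqNgt ie.
have flatE i : i.+1 = e -> flat j n f = (f i == e + j.+1).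
  by move=> ie; rewrite /flat -/e -ie /= ie fe.
(* Row i of the image is shorter than i + j after e and longer than i + j + 1 before e. Row e is
   either e + j, exactly in the flat case, or longer than e + j + 1. *)
have Bgt i : e < i -> add_row j n f i < i + j.
  by move=> ei; rewrite Fgt //; have := ge_e i; lia.
(* Rank below j makes the new first row longer than the old one. *)
have B0 : j.+1 < add_row j n f 0 by have := le_e 0; rewrite F0; lia.
have Blt i : i < e -> i + j.+1 < add_row j n f i.
  by case: i => [//|i] ie; rewrite Flt //; have := le_e i; lia.
have Be : if flat j n f then add_row j n f e = e + j else e + j.+1 < add_row j n f e.
  case E: e => [|i]; first by rewrite /flat -/e E.
  have := le_e i; rewrite (Feq _ (esym E)) (flatE _ (esym E)) E.
  by case: eqP => [->|]; lia.
have rF : is_row n (add_row j n f).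
  split=> // [i|]; last by rewrite Fgt // fn.
  have [lt|lt|Ei] := ltngtP i.+1 e.
  - rewrite Flt //; case: i lt => [|i] lt; first by rewrite F0; lia.
    by rewrite Flt; [exact: decr|lia].
  - have [Ei|ltei] : i = e \/ e < i by lia.
      by have := Bgt e.+1 (leqnn _); move: Be; rewrite Ei; case: ifP; lia.
    by rewrite !Fgt //; have := decr i; lia.
  - rewrite Feq //; case: i Ei => [|i] Ei; first by rewrite F0; lia.
    by rewrite Flt; [have := decr i; lia|lia].
split=> //.
- rewrite /rank_ge F0; suff : conj n (add_row j n f) 0 <= conj n f 0 by lia.
  rewrite leqNgt conjP // -leqNgt.
  have := conjP 0 (conj n f 0) Hf; rewrite ltnn => /esym/negbT.
  have [lt|le] := leqP (conj n f 0) e; first by have := le_e _ lt; lia.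
  by rewrite Fgt //; lia.
- apply/negP => /eqP; move: (diag _ _ _) => i.
  have [lt|lt|->] := ltngtP i e; [have := Blt i lt|have := Bgt i lt|move: Be; case: ifP]; lia.
- move=> i; have [lt|lt|->] := ltngtP i e.
  + by have := Blt i lt; lia.
  + by have := Bgt i lt; lia.
  + by move: Be; case: ifP; lia.
- by move: Be; case: ifP => _; [move->; rewrite eqxx|case: eqP => //; lia].
Qed.

Lemma diag_rank j n : cnt n (has_diag j n) <= cnt n (rank_ge j n).
Proof.
rewrite (cntID n _ (rank_ge j n)) [leqRHS](cntID n _ (has_diag j n)).
apply: leq_add; first by apply: sub_cnt => f _; rewrite andbC.
apply: (cnt_inj (F := add_row j n)).
  by move=> f Hf /andP[h h']; case: (add_rowP Hf h h') => ? -> ->.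
move=> f g Hf /andP[hf hf'] Hg /andP[hg hg'] E.
have [_ _ _ df tf] := add_rowP Hf hf hf'.
have [_ _ _ dg tg] := add_rowP Hg hg hg'.
have Ed : diag j n f = diag j n g.
  by apply/eqP; rewrite eqn_leq -dg -E df leqnn -df E dg leqnn.
have Et : flat j n f = flat j n g by rewrite tf tg Ed E.
have El : conj n f 0 = conj n g 0.
  by have := E 0; rewrite /add_row /= Et; lia.
move: hf hg; rewrite /has_diag Ed; set e := diag j n g => /eqP fe /eqP ge i.
have [lt|lt|->] := ltngtP i e; last by rewrite fe ge.
- have := E i.+1; rewrite /add_row /= Ed -/e lt Et.
  case: eqP => [Ei|_]; last by rewrite andbF !subn0.
  have := @row_decr n f i e Hf (ltnW lt); have := @row_decr n g i e Hg (ltnW lt).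
  by case: (flat j n g) => /=; lia.
- have := E i; rewrite /add_row Ed -/e leqNgt lt /=; case: eqP => [|_]; first by lia.
  (* The predecessor confuses lengths 0 and 1; the number of rows, already recovered, separates
     them. *)
  by have := conjP 0 i Hf; have := conjP 0 i Hg; rewrite El => ->; lia.
Qed.

(** * Partition statistics read off the conjugate *)

Lemma nparts_tail n (mu : mults n) : nparts mu = tail mu 0.
Proof. by []. Qed.

Lemma nones_tail n (mu : mults n) : nones mu = tail mu 0 - tail mu 1.
Proof.
rewrite -[LHS](addnK (tail mu 1)); congr (_ - _).
rewrite [RHS](bigID (fun i : 'I_n => i == 0 :> nat)) /=; congr (_ + _).
by apply: eq_bigl => i; rewrite lt0n.
Qed.

Lemma nparts_gt_ones_tail n (mu : mults n) : nparts_gt_ones mu = tail mu (nones mu).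
Proof. by []. Qed.

Lemma largest_tail n (mu : mults n) : is_partition mu -> largest mu = conj n (tail mu) 0.
Proof.
move=> /is_row_tail Hr; apply/eqP; rewrite eqn_leq; apply/andP; split.
  apply/bigmax_leqP => i mui; rewrite conjP // tail_split; lia.
case E : (conj n (tail mu) 0) => [//|c].
have := conjP 0 c Hr; have := conjP 0 c.+1 Hr; rewrite E leqnn ltnn => tc1 tc.
have cn : c < n by rewrite ltnNge; apply/negP => /(row_eq0 Hr); lia.
apply: (@leq_bigmax_cond _ _ (fun i : 'I_n => i.+1) (Ordinal cn)).
by have := tail_split mu (Ordinal cn) => /=; lia.
Qed.

(** * Cumulative distributions *)

Local Open Scope ring_scope.

Lemma cumul_card n (A : {set mults n}) (g : mults n -> int) (m : int) :
    (forall mu, mu \in A -> g mu <= m -> - n%:Z <= g mu <= n%:Z) ->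
  \sum_(k < (2 * n).+1 | k%:Z - n%:Z <= m)
     #|[set mu in A | g mu == k%:Z - n%:Z]|%:Z = #|[set mu in A | g mu <= m]|%:Z.
Proof.
move=> bnd; rewrite -(big_morph Posz PoszD (erefl _)); congr Posz.
pose h mu : 'I_(2 * n).+1 := inord `|(g mu + n%:Z)%R|%N.
have hE mu : mu \in A -> g mu <= m -> (h mu)%:Z - n%:Z = g mu.
  by move=> Amu /(bnd mu Amu) bmu; rewrite /h inordK; lia.
rewrite -[RHS]sum1_card (partition_big h (fun k => k%:Z - n%:Z <= m)) /=; last first.
  by move=> mu /[!inE]/andP[Amu gm]; rewrite hE.
apply: eq_bigr => k km; rewrite -sum1_card; apply: eq_bigl => mu.
rewrite !inE -andbA; case Amu : (mu \in A) => //=.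
have [gm|gm] := boolP (g mu <= m); last by apply/negP => /eqP E; rewrite E km in gm.
by have := hE mu Amu gm; rewrite -val_eqE /=; lia.
Qed.

(** Only n = 1 needs care: for r < 0 the convention is nonzero only at r = -1, where its value 1 is
    matched by the partition 1, with [pcrank] 0 - 1. *)
Lemma Mcrank_le_card (r : int) (n : nat) : r < 0 ->
  Mcrank r n <= #|[set mu : mults n | is_partition mu & pcrank mu == r]|%:Z.
Proof.
rewrite /Mcrank; case: (n =P 1%N) => // -> r0.
rewrite lt_eqF // (lt_eqF (lt_trans r0 ltr01)) /=; case: eqP => // ->.
have Hr : is_row 1 (fun i => (i == 0%N) : nat) by split; rewrite ?big_ord1.
rewrite lez_nat card_gt0; apply/set0Pn; exists (of_row 1 (fun i => (i == 0%N) : nat)).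
by rewrite inE is_partition_of_row // /pcrank nparts_gt_ones_tail nones_tail !tail_of_row.
Qed.

Theorem theorem1p4 (m : int) (n : nat) :
  m < 0 -> (1 <= n)%N -> cumul Mcrank m n <= cumul Nrank (m + 1) n.
Proof.
(* With this j, crank at most m becomes [crank_le j], and rank at most m + 1 becomes [rank_ge j]. *)
move=> m0 _; pose j := (`|m|.-1)%N; have mj : m = - j.+1%:Z by lia.
pose P := [set mu : mults n | is_partition mu].
apply: (@le_trans _ _ #|[set mu in P | pcrank mu <= m]|%:Z).
  rewrite -cumul_card; first last.
    move=> mu /[!inE] Pmu; have := row_le 0 (is_row_tail Pmu).
    by rewrite /pcrank nparts_gt_ones_tail nones_tail; case: ifP; lia.
  apply: ler_sum => k km; apply: le_trans (Mcrank_le_card _ _) _; first lia.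
  by rewrite lez_nat; apply/subset_leq_card/subsetP => mu /[!inE].
have -> : cumul Nrank (m + 1) n = #|[set mu in P | prank mu <= m + 1]|%:Z.
  rewrite -cumul_card.
    apply: eq_bigr => k _; congr Posz; apply: eq_card => mu; by rewrite !inE.
  move=> mu /[!inE] Pmu _; have Hr := is_row_tail Pmu.
  rewrite /prank largest_tail // nparts_tail; have := row_le 0 Hr.
  by have := row_le 0 (is_row_conj Hr); lia.
have := leq_trans (crank_le_hole j n) (leq_trans (hole_diag j n) (diag_rank j n)).
move=> le_jn; rewrite lez_nat; apply: leq_trans (leq_trans le_jn _).
  apply/subset_leq_card/subsetP => mu /[!inE]/andP[-> /=].
  (* Without ones the crank is the largest part, hence nonnegative and above m. *)
  by rewrite /pcrank /crank_le nparts_gt_ones_tail nones_tail; case: ifP; lia.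
apply/subset_leq_card/subsetP => mu /[!inE]/andP[Pmu].
by rewrite Pmu /prank /rank_ge nparts_tail largest_tail //=; lia.
Qed.
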